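(* For any choice of $\boldsymbol{w}$, the complement of the graph $G^{\boldsymbol{w}}$ is isomorphic to the graph $\Gamma_1$.
   Context: The $E_8$ root system $\Psi_{E_8}\subset\mathbb{R}^8$ consists of the 240 vectors $\pm e_i\pm e_j$ ($1\le i<j\le 8$) and all $x\in\{\pm1\}^8$ with $\prod_i x_i=1$. $G_{E_8}$ is the graph with vertices $v_x$, $x\in\Psi_{E_8}$, where $v_x=v_{-x}$, and $v_x\sim v_y$ iff $\langle x,y\rangle=0$. Let $I=\mathrm{diag}(1,1)$, $X=\begin{pmatrix}0&1\\1&0\end{pmatrix}$, $Z=\mathrm{diag}(1,-1)$, $Y=XZ$. For $M=M_1\otimes M_2\otimes M_3$ with $M_i\in\{I,X,Y,Z\}$, $\sigma_M:v_x\mapsto v_{Mx}$ is an automorphism of $G_{E_8}$ and $L=\{\sigma_M\}\cong\mathbb{Z}_2^6$. Let $V_1,\dots,V_{15}$ be the 15 orbits of $L$ on $V(G_{E_8})$. Given vectors $\boldsymbol{w}=\{w_1,\dots,w_{15}\}\subset\Psi_{E_8}$ with $v_{w_i}\in V_i$, the graph $G^{\boldsymbol{w}}$ has vertex set $V(G_{E_8})$; for $s\in V_i$, $t\in V_j$: if $\langle w_i,w_j\rangle\neq0$ then $s\sim t$ in $G^{\boldsymbol{w}}$ iff $s\sim t$ in $G_{E_8}$; if $\langle w_i,w_j\rangle=0$ then $s\sim t$ in $G^{\boldsymbol{w}}$ iff $s\not\sim t$ in $G_{E_8}$. The folded halved 8-cube graph has as vertices the pairs $\{x,\mathbf{1}+x\}$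 for $x\in\mathbb{F}_2^8$ with $\sum_ix_i=0$ ($\mathbf{1}$ the all-ones vector), two vertices $\{x,\mathbf{1}+x\},\{y,\mathbf{1}+y\}$ being adjacent iff $x+y$ or $x+y+\mathbf{1}$ has exactly two nonzero coordinates. The graph $\Gamma_1$ (Brouwer–Ivanov–Klin) has as vertices one orbit of the independent sets of size 8 of the folded halved 8-cube graph under the group $\mathbb{Z}_2^6\times A_8$ (generated by translations by even-weight vectors and even permutations of the 8 coordinates), namely the orbit of size 120 considered by Brouwer, Ivanov and Klin, giving a strongly regular graph with parameters $(120,56,28,24)$; two vertices are adjacent iff the corresponding independent sets have exactly two points in common. *)

(* Defs.v *)
From mathcomp Require Import all_boot all_order all_algebra all_fingroup.
Set Implicit Arguments. Unset Strict Implicit. Unset Printing Implicit Defensive.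
Import GRing.Theory.
Local Open Scope ring_scope.

Definition graph_iso (U U' : finType) (A : {set U}) (e : rel U)
    (B : {set U'}) (e' : rel U') : Prop :=
  exists f : U -> U',
    [/\ {in A &, injective f}, f @: A = B &
        {in A &, forall u v, e' (f u) (f v) = e u v}].

Definition unitv (i : 'I_8) : 'cV[int]_8 := \col_k ((k == i)%:R).

Definition E8root (x : 'cV[int]_8) : bool :=
  [exists i : 'I_8, exists j : 'I_8, (i < j)%N &&
     [exists s : bool * bool,
        x == (-1) ^+ s.1 *: unitv i + (-1) ^+ s.2 *: unitv j]]
  || ([forall i, (x i 0 == 1) || (x i 0 == -1)] && (\prod_i x i 0 == 1)).

Definition dotZ (x y : 'cV[int]_8) : int := \sum_i x i 0 * y i 0.

(* Every root has coordinates in {-1,0,1}; we encode such vectors by the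
   finite type cvec (value k : 'I_3 stands for the integer k - 1).     *)
Definition cvec := {ffun 'I_8 -> 'I_3}.
Definition toZ (c : cvec) : 'cV[int]_8 := \col_i ((c i : nat)%:Z - 1).

Definition vertex_of (x : 'cV[int]_8) : {set cvec} :=
  [set c | (toZ c == x) || (toZ c == - x)].

Definition VE8 : {set {set cvec}} :=
  [set vertex_of (toZ c) | c in [pred c : cvec | E8root (toZ c)]].

Definition adjE8 (s t : {set cvec}) : bool :=
  [exists c in s, exists d in t, dotZ (toZ c) (toZ d) == 0].

Definition pI : 'M[int]_2 := 1%:M.
Definition pX : 'M[int]_2 := \matrix_(i, j) (if i == j then 0 else 1).
Definition pZ : 'M[int]_2 :=
  \matrix_(i, j) (if i == j then (if i == 0 then 1 else -1) else 0).
Definition pY : 'M[int]_2 := pX *m pZ.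

Definition pauli (k : 'I_4) : 'M[int]_2 :=
  match val k with 0 => pI | 1 => pX | 2 => pY | _ => pZ end.

Definition bit (k : nat) (i : 'I_8) : 'I_2 := inord ((i %/ 2 ^ k) %% 2).

(* Kronecker product A (x) B (x) C, row/column index 4a+2b+c <-> (a,b,c) *)
Definition kron3 (A B C : 'M[int]_2) : 'M[int]_8 :=
  \matrix_(i, j) (A (bit 2 i) (bit 2 j) * B (bit 1 i) (bit 1 j)
                  * C (bit 0 i) (bit 0 j)).

Definition sigmaM (M : 'M[int]_8) (s : {set cvec}) : {set cvec} :=
  [set c | [exists d in s, toZ c == M *m toZ d]].

Definition Lelt (t : 'I_4 * 'I_4 * 'I_4) : 'M[int]_8 :=
  kron3 (pauli t.1.1) (pauli t.1.2) (pauli t.2).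

Definition Lorbit (s : {set cvec}) : {set {set cvec}} :=
  [set sigmaM (Lelt t) s | t : 'I_4 * 'I_4 * 'I_4].

(* The graph G^w.  A choice w is a function assigning to each L-orbit O
   (a set of vertices) a vector w O; see the hypothesis in the theorem. *)
Definition adjGw (w : {set {set cvec}} -> 'cV[int]_8) (s t : {set cvec}) :
    bool :=
  if dotZ (w (Lorbit s)) (w (Lorbit t)) != 0 then adjE8 s t
  else ~~ adjE8 s t.

Definition compl_adjGw (w : {set {set cvec}} -> 'cV[int]_8)
    (s t : {set cvec}) : bool :=
  (s != t) && ~~ adjGw w s t.

Definition F2v := 'rV['F_2]_8.
Definition wt (x : F2v) : nat := #|[set i | x 0 i != 0]|.
Definition one8 : F2v := const_mx 1.

Definition FHverts : {set {set F2v}} :=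
  [set [set x; x + one8] | x in [pred x : F2v | \sum_i x 0 i == 0]].

Definition adjFH (u v : {set F2v}) : bool :=
  [exists x in u, exists y in v,
     (wt (x + y) == 2%N) || (wt (x + y + one8) == 2%N)].

Definition indep8 (I : {set {set F2v}}) : bool :=
  [&& I \subset FHverts, #|I| == 8%N &
      [forall u in I, forall v in I, ~~ adjFH u v]].

(* the group Z_2^6 x A_8: x |-> p x + t, t of even weight, p even *)
Definition permv (p : {perm 'I_8}) (x : F2v) : F2v := \row_i x 0 ((p^-1)%g i).
Definition actFH (t : F2v) (p : {perm 'I_8}) (u : {set F2v}) : {set F2v} :=
  [set permv p x + t | x in u].
Definition actI (t : F2v) (p : {perm 'I_8}) (I : {set {set F2v}}) :
    {set {set F2v}} :=
  [set actFH t p u | u in I].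

Definition G1orbit (I : {set {set F2v}}) : {set {set {set F2v}}} :=
  [set actI tp.1 tp.2 I | tp in
     [pred tp : F2v * {perm 'I_8} |
        (\sum_i tp.1 0 i == 0) && ~~ odd_perm tp.2]].

Definition adjG1 (I J : {set {set F2v}}) : bool := #|I :&: J| == 2%N.

(* Main.v *)
Require Import Defs.
From mathcomp Require Import all_boot all_order all_algebra all_fingroup.
From mathcomp Require Import zify.
Set Implicit Arguments. Unset Strict Implicit. Unset Printing Implicit Defensive.
Import GRing.Theory.
Local Open Scope ring_scope.

(**
Identify L with F_2^6 by writing its elements as X^x Z^z with x, z in F_2^3.  The stabilisers of the 15 orbits are 15 subspaces S_i of order 8, any two of which meet in a subgroup {0, g_ij}, and the orbit V_i is a torsor under F_2^6 / S_i.  If r_i and r_j lie in distinct orbits, then whether r_i and v r_j are orthogonal depends on v only through the symplectic product of v with g_ij, and changes with it.  Measuring each vertex s of V_i from the base point w_i, that is, sending it to the coset { v | v w_i = s } of S_i, therefore cancels the complementations in the definition of G^w: two vertices are adjacent in the complement of G^w iff their cosets have exactly two elements in common.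

A linear map theta sends F_2^6 isomorphically onto the even vectors modulo the all-ones vector, and the 15 subspaces S_i to the images of one extended Hamming code under the powers of an even permutation of order 15.

Conversely, the translations act on an orbit of 120 independent sets, and since 16 does not divide 120 some member has a translation stabiliser of order at least 16 among the even vectors.  This member is then a coset of a code all of whose words other than 0 and 1 have weight 4, which is the extended Hamming code up to a permutation of the coordinates.  If that permutation is odd, it is corrected by a transposition.
*)

(** * Pauli matrices acting on coordinates *)

Local Notation bits3 := (bool * bool * bool)%type.
Local Notation pauli3 := (bits3 * bits3)%type.

Definition dotb (x y : bits3) : bool :=
  (x.1.1 && y.1.1) (+) (x.1.2 && y.1.2) (+) (x.2 && y.2).

Lemma dotbDl x y z : dotb (x + y) z = dotb x z (+) dotb y z.
Proof. by move: x y z => [[[] []] []] [[[] []] []] [[[] []] []]. Qed.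

Lemma dotbDr x y z : dotb x (y + z) = dotb x y (+) dotb x z.
Proof. by move: x y z => [[[] []] []] [[[] []] []] [[[] []] []]. Qed.

Lemma addbb3 (x : bits3) : x + x = 0.
Proof. by move: x => [[[] []] []]. Qed.

Lemma addpp (v : pauli3) : v + v = 0.
Proof. by case: v => x z; rewrite -[LHS]/(x + x, z + z) !addbb3. Qed.

Lemma addKp (u v : pauli3) : u + (u + v) = v.
Proof. by rewrite addrA addpp add0r. Qed.

Lemma ix_proof (b : bits3) : (b.1.1 * 4 + b.1.2 * 2 + b.2 < 8)%N.
Proof. by move: b => [[[] []] []]. Qed.

Definition ix (b : bits3) : 'I_8 := Ordinal (ix_proof b).

Definition bits_of (k : nat) : bits3 := (odd (k %/ 4), odd (k %/ 2), odd k).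

Lemma ixK : cancel ix bits_of.
Proof. by move=> [[[] []] []]. Qed.

Lemma bits_ofK : cancel (bits_of : 'I_8 -> bits3) ix.
Proof. by move=> [k ltk8]; apply/val_inj; move: k ltk8; do 8!case=> //. Qed.

Lemma ix_bij : bijective ix.
Proof. by exists (fun i : 'I_8 => bits_of i); [apply: ixK | apply: bits_ofK]. Qed.

Definition enum_bits3 : seq bits3 :=
  [seq (p, c) | p <- [seq (a, b) | a <- [:: false; true], b <- [:: false; true]],
                c <- [:: false; true]].

Definition enum_pauli3 : seq pauli3 :=
  [seq (x, z) | x <- enum_bits3, z <- enum_bits3].

Lemma mem_enum_bits3 b : b \in enum_bits3.
Proof. by move: b => [[[] []] []]. Qed.

Lemma mem_enum_pauli3 v : v \in enum_pauli3.
Proof. by case: v => x z; apply: allpairs_f; apply: mem_enum_bits3. Qed.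

Lemma enum_pauli3_uniq : uniq enum_pauli3.
Proof. by vm_compute. Qed.

Lemma all_bits3P (P : pred bits3) : reflect (forall b, P b) (all P enum_bits3).
Proof. by apply: (iffP allP) => h b; [apply/h/mem_enum_bits3 | move=> _]. Qed.

Lemma all_pauli3P (P : pred pauli3) :
  reflect (forall v, P v) (all P enum_pauli3).
Proof. by apply: (iffP allP) => h b; [apply/h/mem_enum_pauli3 | move=> _]. Qed.

Lemma all_iotaP n (P : pred nat) :
  reflect (forall i, (i < n)%N -> P i) (all P (iota 0 n)).
Proof. by apply: (iffP allP) => h i; [move=> hi; apply: h | move: (h i)]; rewrite mem_iota. Qed.

Lemma card_pauli3 (P : pred pauli3) : #|[set v | P v]| = size (filter P enum_pauli3).
Proof.
rewrite cardsE -(card_uniqP _) ?filter_uniq ?enum_pauli3_uniq //.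
by apply: eq_card => v; rewrite mem_filter mem_enum_pauli3 andbT.
Qed.

Lemma big_bits3 (R : Type) (idx : R) (op : Monoid.com_law idx) (F : bits3 -> R) :
  \big[op/idx]_b F b = \big[op/idx]_(b <- enum_bits3) F b.
Proof.
apply: perm_big; apply: uniq_perm; rewrite ?index_enum_uniq // => b.
by rewrite mem_index_enum mem_enum_bits3.
Qed.

(** A plain fold over an explicit list, so that the finite checks on inner products can be
    evaluated. *)
Definition sumb (F : bits3 -> int) : int := foldr (fun b z => F b + z) 0 enum_bits3.

Lemma sumbE F : \sum_(i : 'I_8) F (bits_of i) = sumb F.
Proof.
rewrite (reindex ix) /=; last exact: onW_bij ix_bij.
by under eq_bigr do rewrite (ixK); rewrite big_bits3 unlock.
Qed.

Definition coords (x : 'cV[int]_8) (b : bits3) : int := x (ix b) 0.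

Lemma coordsP x y : coords x =1 coords y -> x = y.
Proof.
by move=> h; apply/colP=> k; rewrite -[k](bits_ofK) -!/(coords _ _) h.
Qed.

Lemma coordsN x b : coords (- x) b = - coords x b.
Proof. by rewrite /coords mxE. Qed.

Lemma dotZE x y : dotZ x y = sumb (fun b => coords x b * coords y b).
Proof.
rewrite -sumbE; apply: eq_bigr => i _.
by rewrite /coords bits_ofK.
Qed.

(** The matrix X^x Z^z on coordinate functions: Z^z acts first, so its sign is read at the source
    index [b + x]. *)
Definition pact (v : pauli3) (F : bits3 -> int) (b : bits3) : int :=
  let z := F (b + v.1) in if dotb v.2 (b + v.1) then - z else z.

Lemma pactE v F b : pact v F b = (-1) ^+ dotb v.2 (b + v.1) * F (b + v.1).
Proof. by rewrite mulr_sign. Qed.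

(* [pauli] lists I, X, Y = XZ, Z, so the index of X^p Z^q is 0, 1, 2, 3 for (p, q) = (0, 0), (1, 0), (1, 1), (0, 1). *)
Definition pauli_index (p q : bool) : 'I_4 :=
  match p, q with
  | false, false => @Ordinal 4 0 isT
  | true, false => @Ordinal 4 1 isT
  | true, true => @Ordinal 4 2 isT
  | false, true => @Ordinal 4 3 isT
  end.

Definition pauli_triple (v : pauli3) : 'I_4 * 'I_4 * 'I_4 :=
  (pauli_index v.1.1.1 v.2.1.1, pauli_index v.1.1.2 v.2.1.2,
   pauli_index v.1.2 v.2.2).

Lemma pauli_indexE (k : 'I_4) : exists p q, k = pauli_index p q.
Proof.
case: k; do 4?[case]=> // lt.
- by exists false, false; apply/val_inj.
- by exists true, false; apply/val_inj.
- by exists true, true; apply/val_inj.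
- by exists false, true; apply/val_inj.
Qed.

Lemma pauli_tripleE t : exists v, t = pauli_triple v.
Proof.
case: t => [[k1 k2] k3].
have [p1 [q1 ->]] := pauli_indexE k1.
have [p2 [q2 ->]] := pauli_indexE k2.
have [p3 [q3 ->]] := pauli_indexE k3.
by exists ((p1, p2, p3), (q1, q2, q3)).
Qed.

Definition ord_bool (b : bool) : 'I_2 :=
  if b then @Ordinal 2 1 isT else @Ordinal 2 0 isT.

Lemma bit_ix b : [/\ bit 2 (ix b) = ord_bool b.1.1,
  bit 1 (ix b) = ord_bool b.1.2 & bit 0 (ix b) = ord_bool b.2].
Proof.
by move: b => [[[] []] []]; split; apply/val_inj; rewrite /= inordK.
Qed.

Lemma pauli_entry p q a c :
  pauli (pauli_index p q) (ord_bool a) (ord_bool c) =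
    if c == a (+) p then (-1) ^+ (q && c) else 0.
Proof.
case: p q => [] []; rewrite /pauli /= /pY !mxE ?big_ord_recl ?big_ord0 ?mxE;
  by case: a c => [] []; rewrite ?mxE.
Qed.

Definition LL (v : pauli3) : 'M[int]_8 := Lelt (pauli_triple v).

Lemma LL_entry v b c :
  LL v (ix b) (ix c) = if c == b + v.1 then (-1) ^+ dotb v.2 c else 0.
Proof.
have [b2 b1 b0] := bit_ix b; have [c2 c1 c0] := bit_ix c.
rewrite /LL /Lelt /kron3 mxE /= b2 b1 b0 c2 c1 c0 !pauli_entry.
move: v b c {b2 b1 b0 c2 c1 c0} => [[[x2 x1] x0] [[z2 z1] z0]] [[b2 b1] b0] [[c2 c1] c0].
rewrite /dotb /=.
(* Equality of triples is unfolded bit by bit, matching the three tensor factors. *)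
rewrite -[RHS]/(if [&& (c2 == b2 (+) x2) && (c1 == b1 (+) x1) & c0 == b0 (+) x0] then _ else _).
case: (c2 == _); case: (c1 == _); case: (c0 == _); rewrite ?(mul0r, mulr0) //=.
by rewrite !signr_addb.
Qed.

Lemma coordsLL v x : coords (LL v *m x) =1 pact v (coords x).
Proof.
move=> b; rewrite pactE /coords mxE (reindex ix) /=; last exact: onW_bij ix_bij.
rewrite (bigD1 (b + v.1)) //= LL_entry eqxx big1 ?addr0 // => c /negbTE ne.
by rewrite LL_entry ne mul0r.
Qed.

Lemma coordsZ a x b : coords (a *: x) b = a * coords x b.
Proof. by rewrite /coords mxE. Qed.

(** Moving the Z part of [u] past the X part of [v] costs this sign. Vertices do not see it, so L
    acts on them as the additive group F_2^6. *)
Lemma LL_mul u v (x : 'cV[int]_8) :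
  LL u *m (LL v *m x) = (-1) ^+ dotb u.2 v.1 *: (LL (u + v) *m x).
Proof.
apply: coordsP => b; rewrite coordsLL coordsZ coordsLL.
rewrite !pactE coordsLL pactE -[(u + v).1]/(u.1 + v.1) -[(u + v).2]/(u.2 + v.2).
rewrite !mulrA -!signr_addb !addrA; congr ((-1) ^+ nat_of_bool _ * _).
rewrite dotbDl !dotbDr.
by case: (dotb u.2 b) (dotb u.2 u.1) (dotb v.2 b) (dotb v.2 u.1) (dotb v.2 v.1)
  (dotb u.2 v.1) => [] [] [] [] [] [].
Qed.

Lemma LL0 (x : 'cV[int]_8) : LL 0 *m x = x.
Proof.
apply: coordsP => b; rewrite coordsLL pactE addr0.
by rewrite (_ : dotb _ b = false) ?mul1r.
Qed.

Lemma dotZ_LL v x y : dotZ (LL v *m x) (LL v *m y) = dotZ x y.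
Proof.
rewrite !dotZE -!sumbE.
under eq_bigr => i _ do
  rewrite !coordsLL !pactE mulrACA -signr_addb addbb mul1r.
rewrite (reindex ix); last exact: onW_bij ix_bij.
rewrite [RHS](reindex ix); last exact: onW_bij ix_bij.
rewrite [RHS](reindex_inj (addIr v.1)).
by apply: eq_bigr => b _; rewrite !ixK.
Qed.

Lemma dotZNr x y : dotZ x (- y) = - dotZ x y.
Proof. by rewrite /dotZ -sumrN; apply: eq_bigr => i _; rewrite mxE mulrN. Qed.

Lemma dotZNl x y : dotZ (- x) y = - dotZ x y.
Proof. by rewrite /dotZ -sumrN; apply: eq_bigr => i _; rewrite mxE mulNr. Qed.

(** * Vertices as sign classes of ternary vectors *)

Definition eqpm (x y : 'cV[int]_8) := (x == y) || (x == - y).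

Lemma eqpm_sign (b : bool) x y : eqpm ((-1) ^+ b *: x) y = eqpm x y.
Proof.
by case: b; rewrite ?expr0 ?expr1 ?scale1r // scaleN1r /eqpm eqr_oppLR eqr_opp orbC.
Qed.

Lemma eqpm_signr (b : bool) x y : eqpm x ((-1) ^+ b *: y) = eqpm x y.
Proof.
by case: b; rewrite ?expr0 ?expr1 ?scale1r // scaleN1r /eqpm opprK orbC.
Qed.

Lemma eqpm_LL v x y : eqpm (LL v *m x) (LL v *m y) = eqpm x y.
Proof.
have inj : injective (mulmx (LL v) : 'cV[int]_8 -> _).
  move=> z t /(congr1 (mulmx (LL v))); rewrite !LL_mul addpp !LL0.
  exact: (can_inj (signrZK _)).
by rewrite /eqpm -mulmxN !(inj_eq inj).
Qed.

(** These are the values of [toZ]. Every other vector has an empty [vertex_of], which is why the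
    lemmas on vertices carry this hypothesis. *)
Definition ternary (x : 'cV[int]_8) : bool := [forall i, x i 0 \in [:: 0; 1; -1]].

Lemma ternaryP x : reflect (exists c, toZ c = x) (ternary x).
Proof.
apply: (iffP forallP) => [h | [c <-] i]; last first.
  rewrite mxE; move: (c i) => [k lt]; rewrite /=.
  by move: k lt; do 3!case=> //.
exists [ffun i => if x i 0 == 0 then @Ordinal 3 1 isT
   else if x i 0 == 1 then @Ordinal 3 2 isT else @Ordinal 3 0 isT].
apply/colP=> i; rewrite mxE ffunE.
by have := h i; rewrite !inE => /or3P[] /eqP ->.
Qed.

Lemma ternaryN x : ternary x -> ternary (- x).
Proof.
move/forallP=> h; apply/forallP=> i; have := h i; rewrite mxE !inE.
by case/or3P=> /eqP->.
Qed.

Lemma ternary_LL v x : ternary x -> ternary (LL v *m x).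
Proof.
move/forallP=> h; apply/forallP=> i.
rewrite -[i]bits_ofK -/(coords _ _) coordsLL /pact /coords.
have := h (ix (bits_of i + v.1)); rewrite !inE.
by case: dotb => /or3P[] /eqP->.
Qed.

Lemma in_vertex_of c x : (c \in vertex_of x) = eqpm (toZ c) x.
Proof. by rewrite inE. Qed.

Lemma vertex_of_eq x y : ternary x -> (vertex_of x == vertex_of y) = eqpm x y.
Proof.
case/ternaryP=> c <-; apply/eqP/idP=> [e | ].
  by rewrite -in_vertex_of -e in_vertex_of /eqpm eqxx.
case/orP => /eqP ->; apply/setP=> d; rewrite !in_vertex_of //.
by rewrite -scaleN1r -[-1]expr1 -[1%N]/(nat_of_bool true) eqpm_signr.
Qed.

Lemma adjE8_vertex_of x y : ternary x -> ternary y ->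
  adjE8 (vertex_of x) (vertex_of y) = (dotZ x y == 0).
Proof.
move=> /ternaryP[c <-] /ternaryP[d <-]; apply/idP/idP.
  case/existsP=> c' /andP[+ /existsP[d' /andP[]]]; rewrite !in_vertex_of.
  by case/orP=> /eqP-> /orP[] /eqP->; rewrite ?dotZNl ?dotZNr ?opprK ?oppr_eq0.
move=> h; apply/existsP; exists c; rewrite in_vertex_of /eqpm eqxx.
by apply/existsP; exists d; rewrite in_vertex_of /eqpm eqxx.
Qed.

Lemma sigmaM_vertex_of v x : ternary x ->
  sigmaM (LL v) (vertex_of x) = vertex_of (LL v *m x).
Proof.
move=> tx; apply/setP=> c; rewrite in_vertex_of inE; apply/existsP/idP.
  case=> d /andP[]; rewrite in_vertex_of => h /eqP ->; by rewrite eqpm_LL.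
case/orP=> /eqP e.
  have/ternaryP[d ed] := tx; exists d.
  by rewrite in_vertex_of ed e /eqpm !eqxx.
have/ternaryP[d ed] := ternaryN tx; exists d.
by rewrite in_vertex_of ed e /eqpm mulmxN !eqxx orbT.
Qed.

(* One root from each orbit, in the order in which [singer] permutes the corresponding codes. *)
Definition root_coords : seq (seq int) :=
  [:: [:: 1; 1; 1; 1; 1; 1; 1; 1];
      [:: 1; 1; 1; -1; 1; 1; -1; 1];
      [:: 1; 1; 1; -1; 1; -1; 1; 1];
      [:: 1; 1; 0; 0; 0; 0; 0; 0];
      [:: 1; 1; 1; 1; 1; 1; -1; -1];
      [:: 1; 0; 0; 0; 1; 0; 0; 0];
      [:: 1; 1; 1; 1; 1; -1; 1; -1];
      [:: 1; 1; 1; 1; 1; -1; -1; 1];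
      [:: 1; 0; 1; 0; 0; 0; 0; 0];
      [:: 1; 0; 0; 0; 0; 0; 1; 0];
      [:: 1; 1; 1; -1; 1; 1; 1; -1];
      [:: 1; 0; 0; 0; 0; 0; 0; 1];
      [:: 1; 0; 0; 0; 0; 1; 0; 0];
      [:: 1; 0; 0; 1; 0; 0; 0; 0];
      [:: 1; 1; 1; -1; 1; -1; -1; -1]].

Definition rootc (i : nat) (b : bits3) : int :=
  nth 0 (nth [::] root_coords i) (ix b).

Definition root_rep (i : nat) : 'cV[int]_8 := \col_k rootc i (bits_of k).

Lemma coords_rep i : coords (root_rep i) =1 rootc i.
Proof. by move=> b; rewrite /coords mxE ixK. Qed.

Lemma ternary_rep i : (i < 15)%N -> ternary (root_rep i).
Proof.
have /all_iotaP h :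
    all (fun i => all (fun b => rootc i b \in [:: 0; 1; -1]) enum_bits3) (iota 0 15).
  by vm_compute.
by move=> /h/all_bits3P hi; apply/forallP=> k; rewrite mxE.
Qed.

(** * Finite checks on the fifteen representatives *)

Definition eqpmc (F G : bits3 -> int) : bool :=
  all (fun b => F b == G b) enum_bits3 || all (fun b => F b == - G b) enum_bits3.

Lemma eqpmE x y : eqpm x y = eqpmc (coords x) (coords y).
Proof.
congr (_ || _).
  by apply/eqP/all_bits3P => [-> // | h]; apply: coordsP => b; apply/eqP.
apply/eqP/all_bits3P => [-> b | h]; first by rewrite coordsN.
by apply: coordsP => b; rewrite coordsN; apply/eqP.
Qed.

Lemma eq_eqpmc F F' G G' : F =1 F' -> G =1 G' -> eqpmc F G = eqpmc F' G'.
Proof. by move=> e e'; congr (_ || _); apply: eq_all => b; rewrite e e'. Qed.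

Lemma eq_pact v F F' : F =1 F' -> pact v F =1 pact v F'.
Proof. by move=> e b; rewrite /pact e. Qed.

Definition stab (i : nat) (v : pauli3) : bool := eqpmc (pact v (rootc i)) (rootc i).

Definition orthc (i j : nat) (v : pauli3) : bool :=
  sumb (fun b => rootc i b * pact v (rootc j) b) == 0.

(** The intersection of S_i with [v + S_j]. Up to translation, it is the intersection of two cosets
    of S_i and S_j whose base points differ by [v]. *)
Definition stab_meet (i j : nat) (v : pauli3) : seq pauli3 :=
  [seq t <- [seq t <- enum_pauli3 | stab i t] | stab j (v + t)].

(* Entry 0 of the list is the zero vector, so entry 1 generates the intersection of the two stabilisers. *)
Definition common_stab (i j : nat) : pauli3 :=
  nth 0 [seq t <- enum_pauli3 | stab i t && stab j t] 1.

(** The commutator form: it records whether the matrices of [u] and [v] commute or anticommute. *)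
Definition sympl (u v : pauli3) : bool := dotb u.1 v.2 (+) dotb u.2 v.1.

Lemma symplDr u v t : sympl u (v + t) = sympl u v (+) sympl u t.
Proof. by rewrite /sympl !dotbDr addbACA. Qed.

Lemma distinct_orbits i j v : (i < 15)%N -> (j < 15)%N ->
  eqpmc (pact v (rootc i)) (rootc j) -> i = j.
Proof.
have /all_iotaP h : all (fun i => all (fun j => all (fun v =>
    eqpmc (pact v (rootc i)) (rootc j) ==> (i == j)) enum_pauli3)
    (iota 0 15)) (iota 0 15).
  by vm_compute.
by move=> /h/all_iotaP hj /hj/all_pauli3P hv; have/implyP hh := hv v => /hh/eqP.
Qed.

(** The eight lines of an orbit form an orthogonal frame of R^8. *)
Lemma orth_same_orbit i v : (i < 15)%N -> ~~ stab i v -> orthc i i v.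
Proof.
have /all_iotaP h : all (fun i => all (fun v => ~~ stab i v ==> orthc i i v)
    enum_pauli3) (iota 0 15).
  by vm_compute.
by move=> /h/all_pauli3P hv; have/implyP := hv v.
Qed.

(** Let g be the common stabiliser element. Applying g to both arguments of the inner product of r_i
    and v r_j preserves it, yet multiplies it by a sign that depends on v only through [sympl g v].
    For one value of the form the product must therefore vanish; the computation shows that for the
    other it does not. *)
Lemma orth_sympl i j v : (i < 15)%N -> (j < 15)%N -> i != j ->
  orthc i j v = orthc i j 0 (+) sympl (common_stab i j) v.
Proof.
have /all_iotaP h : all (fun i => all (fun j => (i != j) ==>
    let c := orthc i j 0 in let g := common_stab i j in
    all (fun v => orthc i j v == c (+) sympl g v) enum_pauli3)
    (iota 0 15)) (iota 0 15).
  by vm_compute.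
by move=> /h/all_iotaP hj /hj/implyP hij /hij/all_pauli3P/(_ v)/eqP.
Qed.

(** Elements fixing one root up to sign commute, so S_i and S_j are totally isotropic and S_i + S_j,
    of order 8 * 8 / 2 = 32, is the orthogonal complement of g. The intersection is nonempty iff v
    lies in this sum, and is then a coset of {0, g}. *)
Lemma size_meet i j v : (i < 15)%N -> (j < 15)%N -> i != j ->
  size (stab_meet i j v) = if sympl (common_stab i j) v then 0%N else 2%N.
Proof.
have /all_iotaP h : all (fun i => let Si := [seq t <- enum_pauli3 | stab i t] in
    all (fun j => (i != j) ==>
    let Sj := [seq t <- enum_pauli3 | stab j t] in
    let g := common_stab i j in
    all (fun v => size [seq t <- Si | (v + t) \in Sj] ==
       if sympl g v then 0%N else 2%N) enum_pauli3)
    (iota 0 15)) (iota 0 15).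
  by vm_compute.
move=> /h/all_iotaP hj /hj/implyP hij /hij/all_pauli3P/(_ v)/eqP <-.
by congr size; apply: eq_filter => t; rewrite mem_filter mem_enum_pauli3 andbT.
Qed.

Lemma size_stab i : (i < 15)%N -> size [seq t <- enum_pauli3 | stab i t] = 8%N.
Proof.
have /all_iotaP h : all (fun i => size [seq t <- enum_pauli3 | stab i t] == 8%N)
    (iota 0 15).
  by vm_compute.
by move=> /h/eqP.
Qed.

(** * The fifteen orbits *)

(** A greedy choice of coset representatives of S_i, so that [vertices] names each of the 120
    vertices once. *)
Definition transversal (i : nat) : seq pauli3 :=
  let Si := [seq t <- enum_pauli3 | stab i t] in
  foldr (fun v l => if has (fun u => (u + v) \in Si) l then l else v :: l)
    [::] enum_pauli3.

Definition vertices : seq (nat * pauli3) :=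
  [seq (i, a) | i <- iota 0 15, a <- transversal i].

Definition in_orbits (F : bits3 -> int) : bool :=
  has (fun p => eqpmc F (pact p.2 (rootc p.1))) vertices.

Definition pairc (p : bits3 * bits3) (s : bool * bool) (b : bits3) : int :=
  (-1) ^+ s.1 * (b == p.1)%:R + (-1) ^+ s.2 * (b == p.2)%:R.

Definition signc (s : seq bool) (b : bits3) : int := (-1) ^+ nth false s (ix b).

Definition enum_bool2 : seq (bool * bool) :=
  [seq (a, b) | a <- [:: false; true], b <- [:: false; true]].

Definition is_pairc (F : bits3 -> int) : bool :=
  has (fun p => (ix p.1 < ix p.2)%N &&
    has (fun s => all (fun b => F b == pairc p s b) enum_bits3) enum_bool2)
  [seq (b, c) | b <- enum_bits3, c <- enum_bits3].

Definition is_signc (F : bits3 -> int) : bool :=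
  all (fun b => (F b == 1) || (F b == -1)) enum_bits3 &&
  (foldr (fun b z => F b * z) 1 enum_bits3 == 1).

Lemma eq_is_signc F G : F =1 G -> is_signc F = is_signc G.
Proof.
move=> e; congr (_ && _); first by apply: eq_all => b; rewrite e.
by congr eq_op; elim: enum_bits3 => //= b l ->; rewrite e.
Qed.

Lemma coords_pair i j (s : bool * bool) :
  coords ((-1) ^+ s.1 *: unitv i + (-1) ^+ s.2 *: unitv j) =1
  pairc (bits_of i, bits_of j) s.
Proof.
move=> b; rewrite /coords !mxE /pairc /=.
by rewrite -{1}(bits_ofK i) -{1}(bits_ofK j) !(inj_eq (can_inj ixK)).
Qed.

Lemma prod_coords (x : 'cV[int]_8) :
  \prod_i x i 0 = foldr (fun b z => coords x b * z) 1 enum_bits3.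
Proof.
by rewrite (reindex ix) ?big_bits3 ?unlock //; exact: onW_bij ix_bij.
Qed.

Lemma E8rootE x : E8root x = is_pairc (coords x) || is_signc (coords x).
Proof.
congr (_ || _); last first.
  rewrite /is_signc prod_coords; congr (_ && _).
  apply/forallP/all_bits3P => h b; first exact: h.
  by have := h (bits_of b); rewrite /coords bits_ofK.
apply/existsP/hasP.
  case=> i /existsP[j /andP[lt /existsP[s /eqP ->]]].
  exists (bits_of i, bits_of j); first by apply: allpairs_f; apply: mem_enum_bits3.
  rewrite !bits_ofK lt; apply/hasP; exists s; first by move: s => [[] []].
  by apply/all_bits3P => b; rewrite coords_pair.
case=> [[b c] _ /andP[lt /hasP[s _ /all_bits3P h]]].
exists (ix b); apply/existsP; exists (ix c); rewrite lt; apply/existsP; exists s.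
by apply/eqP/coordsP => d; rewrite coords_pair !ixK; apply/eqP.
Qed.

Lemma eq_in_orbits F G : F =1 G -> in_orbits F = in_orbits G.
Proof. by move=> e; apply: eq_has => p; apply: eq_eqpmc. Qed.

Fixpoint bitseqs (n : nat) : seq (seq bool) :=
  if n is m.+1 then [seq b :: s | b <- [:: false; true], s <- bitseqs m] else [:: [::]].

Lemma mem_bitseqs s : s \in bitseqs (size s).
Proof.
elim: s => // b s IHs.
rewrite -[bitseqs _]/[seq c :: t | c <- [:: false; true], t <- bitseqs (size s)].
by apply: allpairs_f => //; case: b.
Qed.

Lemma pairc_in_orbits p s : (ix p.1 < ix p.2)%N -> in_orbits (pairc p s).
Proof.
have /allP h : all (fun p => (ix p.1 < ix p.2)%N ==>
    all (fun s => in_orbits (pairc p s)) enum_bool2)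
    [seq (b, c) | b <- enum_bits3, c <- enum_bits3].
  by vm_compute.
have/h/implyP hp : p \in [seq (b, c) | b <- enum_bits3, c <- enum_bits3].
  by case: p => b c; apply: allpairs_f; apply: mem_enum_bits3.
by move=> /hp/allP; apply; move: s => [[] []].
Qed.

Lemma is_signc_in_orbits F : is_signc F -> in_orbits F.
Proof.
have /allP h : all (fun s => is_signc (signc s) ==> in_orbits (signc s)) (bitseqs 8).
  by vm_compute.
move=> sF; have /andP[/all_bits3P F1 _] := sF.
(* [enum_bits3] runs in the order of [ix], so entry [ix b] of [s] tells whether [F b] is -1. *)
pose s := [seq F b == -1 | b <- enum_bits3].
have e : F =1 signc s.
  move=> b; have := F1 b; rewrite /signc /s.
  by move: b => [[[] []] []] /= /orP[] /eqP ->.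
rewrite (eq_in_orbits e); rewrite (eq_is_signc e) in sF.
by move/implyP: (h s (mem_bitseqs s)); apply.
Qed.

Lemma vertices_lt p : p \in vertices -> (p.1 < 15)%N.
Proof. by rewrite /vertices => /allpairsPdep[i [a [+ _ ->]]]; rewrite mem_iota. Qed.

Lemma E8root_ternary x : E8root x -> ternary x.
Proof.
rewrite E8rootE; case/orP.
  case/hasP=> p _ /andP[lt /hasP[s _ /all_bits3P h]].
  apply/forallP=> i; rewrite -[i]bits_ofK; rewrite -/(coords _ _) (eqP (h _)).
  rewrite /pairc; have ne : p.1 != p.2 by apply: contraTneq lt => ->; rewrite ltnn.
  case: eqP => [e | _]; case: eqP => [e' | _]; first by rewrite -e -e' eqxx in ne.
  - by case: (s.1); case: (s.2).
  - by case: (s.1); case: (s.2).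
  - by case: (s.1); case: (s.2).
case/andP=> /all_bits3P h _; apply/forallP=> i; rewrite -[i]bits_ofK !inE.
by rewrite -/(coords _ _); case/orP: (h (bits_of i)) => ->; rewrite ?orbT.
Qed.

Definition vx (i : nat) (a : pauli3) : {set cvec} := vertex_of (LL a *m root_rep i).

Lemma ternary_vx i a : (i < 15)%N -> ternary (LL a *m root_rep i).
Proof. by move=> lt; apply/ternary_LL/ternary_rep. Qed.

Lemma VE8_vx s : s \in VE8 -> exists i a, (i < 15)%N /\ s = vx i a.
Proof.
case/imsetP=> c; rewrite inE => rc ->.
have: in_orbits (coords (toZ c)).
  move: (rc); rewrite E8rootE; case/orP; last exact: is_signc_in_orbits.
  case/hasP=> p _ /andP[lt /hasP[t _ /all_bits3P h]].
  by rewrite (eq_in_orbits (G := pairc p t)) ?pairc_in_orbits // => b; apply/eqP.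
rewrite /in_orbits => /hasP[[i v] /vertices_lt lti e]; exists i, v; split=> //.
apply/eqP; rewrite vertex_of_eq; last exact: E8root_ternary.
rewrite eqpmE (eq_eqpmc (F' := coords (toZ c)) (G' := pact v (rootc i))) //.
move=> b; rewrite coordsLL; apply: eq_pact; exact: coords_rep.
Qed.

Lemma eq_is_pairc F G : F =1 G -> is_pairc F = is_pairc G.
Proof.
move=> e; apply: eq_has => p; congr (_ && _); apply: eq_has => s.
by apply: eq_all => b; rewrite e.
Qed.

Lemma vx_VE8 p : p \in vertices -> vx p.1 p.2 \in VE8.
Proof.
have /allP h : all (fun p => is_pairc (pact p.2 (rootc p.1)) ||
    is_signc (pact p.2 (rootc p.1))) vertices.
  by vm_compute.
case: p => i a pin; have /= lti := vertices_lt pin.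
have /ternaryP[c ec] := ternary_vx a lti.
rewrite /vx -ec; apply: imset_f; rewrite inE ec E8rootE.
have e : coords (LL a *m root_rep i) =1 pact a (rootc i).
  by move=> b; rewrite coordsLL; apply: eq_pact; exact: coords_rep.
rewrite (eq_is_pairc e) (eq_is_signc e).
exact: (h (i, a)).
Qed.

Lemma sigmaM_vx v i a : (i < 15)%N -> sigmaM (LL v) (vx i a) = vx i (v + a).
Proof.
move=> lti; rewrite sigmaM_vertex_of ?ternary_vx // LL_mul.
by apply/eqP; rewrite eq_sym vertex_of_eq ?ternary_vx // eqpm_signr /eqpm eqxx.
Qed.

Lemma vx_eq i j a b : (i < 15)%N -> (j < 15)%N ->
  (vx i a == vx j b) = (i == j) && stab i (a + b).
Proof.
(* Applying [LL b] to both roots brings the second back to its representative, because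
   [b + b = 0]. *)
move=> lti ltj; rewrite vertex_of_eq ?ternary_vx // -(eqpm_LL b) !LL_mul.
rewrite eqpm_sign eqpm_signr addpp LL0 addrC eqpmE.
rewrite (eq_eqpmc (F' := pact (a + b) (rootc i)) (G' := rootc j)); first last.
- exact: coords_rep.
- by move=> c; rewrite coordsLL; apply: eq_pact; apply: coords_rep.
apply/idP/andP => [e | [/eqP <- //]].
by have eij := distinct_orbits lti ltj e; rewrite -eij in e; rewrite eij eqxx -eij.
Qed.

Lemma eq_sumb F G : F =1 G -> sumb F = sumb G.
Proof. by move=> e; rewrite -!sumbE; apply: eq_bigr => i _; apply: e. Qed.

Lemma dotZ_vx i j a b :
  (dotZ (LL a *m root_rep i) (LL b *m root_rep j) == 0) = orthc i j (a + b).
Proof.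
have dZ c x y : (dotZ x ((-1) ^+ (c : bool) *: y) == 0) = (dotZ x y == 0).
  by case: c; rewrite ?scale1r ?scaleN1r ?dotZNr ?oppr_eq0.
(* Up to sign [LL b] is [LL a] times [LL (a + b)], and [LL a] is an isometry. *)
have := LL_mul a (a + b) (root_rep j); rewrite addKp => e.
rewrite -(dZ (dotb a.2 (a + b).1)) -e dotZ_LL dotZE; congr (eq_op _ _).
by apply: eq_sumb => c; rewrite coords_rep coordsLL (eq_pact _ (coords_rep j)).
Qed.

Lemma adjE8_vx i j a b : (i < 15)%N -> (j < 15)%N ->
  adjE8 (vx i a) (vx j b) = orthc i j (a + b).
Proof. by move=> lti ltj; rewrite adjE8_vertex_of ?ternary_vx // dotZ_vx. Qed.

Lemma Lorbit_vx i a : (i < 15)%N -> Lorbit (vx i a) = [set vx i b | b : pauli3].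
Proof.
move=> lti; apply/setP=> s; apply/imsetP/imsetP => [[t _ ->] | [b _ ->]].
  by have [v ->] := pauli_tripleE t; exists (v + a); rewrite // sigmaM_vx.
exists (pauli_triple (b + a)) => //.
by rewrite [RHS]sigmaM_vx // -addrA addpp addr0.
Qed.

Lemma orth_self i : (i < 15)%N -> ~~ orthc i i 0.
Proof. by apply/all_iotaP: i; vm_compute. Qed.

(** Supplies surjectivity: an injection of [VE8] into an orbit of 120 independent sets is onto. *)
Lemma card_VE8_ge : (120 <= #|VE8|)%N.
Proof.
have /allP h : all (fun p => all (fun q =>
    ((p.1 == q.1) && stab p.1 (p.2 + q.2)) ==> (p == q)) vertices) vertices.
  by vm_compute.
have su : (size vertices == 120%N) && uniq vertices by vm_compute.
have /andP[/eqP <- u] := su.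
have inj : {in vertices &, injective (fun p => vx p.1 p.2)}.
  move=> p q pin qin /eqP; rewrite vx_eq; [|exact: vertices_lt..] => e.
  by apply/eqP; move/implyP: (allP (h p pin) q qin); apply.
rewrite -(size_map (fun p => vx p.1 p.2)) cardE; apply: uniq_leq_size.
  rewrite (map_inj_in_uniq inj); exact: u.
by move=> _ /mapP[p pin ->]; rewrite mem_enum vx_VE8.
Qed.

(** * Labelling vertices by cosets *)

Definition label (w : {set {set cvec}} -> 'cV[int]_8) (s : {set cvec}) : {set pauli3} :=
  [set v | sigmaM (LL v) (vertex_of (w (Lorbit s))) == s].

Definition orbit_choice (w : {set {set cvec}} -> 'cV[int]_8) : Prop :=
  forall s, s \in VE8 ->
    E8root (w (Lorbit s)) && (vertex_of (w (Lorbit s)) \in Lorbit s).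

Definition coset_of_stab (i : nat) (c : pauli3) : {set pauli3} :=
  [set v : pauli3 | stab i (v + c)].

Lemma card_coset_meet i j (c d : pauli3) :
  #|coset_of_stab i c :&: coset_of_stab j d| = size (stab_meet i j (c + d)).
Proof.
rewrite /stab_meet -filter_predI -card_pauli3 -(card_imset _ (addIr c)).
apply: eq_card => v; rewrite !inE; apply/idP/imsetP => [|[t]].
  move=> /andP[h h']; exists (v + c); last by rewrite -addrA addpp addr0.
  by rewrite inE /= h andbT addrC addrA -[v + c + c]addrA addpp addr0.
rewrite inE /= => /andP[h h'] ->.
by rewrite -[t + c + c]addrA addpp addr0 h' -addrA addrC h.
Qed.

Lemma card_coset_of_stab i c : (i < 15)%N -> #|coset_of_stab i c| = 8%N.
Proof.
move=> lti; rewrite -[LHS](card_imset _ (addIr c)) -(size_stab lti) -card_pauli3.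
apply: eq_card => v; rewrite inE; apply/imsetP/idP => [[t]|h].
  by rewrite inE => h ->.
by exists (v + c); rewrite ?inE -addrA addpp addr0.
Qed.

Section OrbitChoice.
Variables (w : {set {set cvec}} -> 'cV[int]_8) (wP : orbit_choice w).

(** Here [p] is the displacement of the chosen base point from [root_rep i]; measuring from the base
    point shifts the coset by [p]. *)
Lemma choice_vx i a : (i < 15)%N -> vx i a \in VE8 ->
  exists p : pauli3, [/\ label w (vx i a) = coset_of_stab i (p + a)
     & eqpm (w (Lorbit (vx i a))) (LL p *m root_rep i)].
Proof.
move=> lti /wP/andP[/E8root_ternary tw]; rewrite {2}Lorbit_vx //.
case/imsetP=> p _ e; exists p; split.
  by apply/setP=> v; rewrite !inE e sigmaM_vx // vx_eq // eqxx addrA.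
by rewrite -vertex_of_eq // e.
Qed.

Lemma label_coset s : s \in VE8 ->
  exists i c, (i < 15)%N /\ label w s = coset_of_stab i c.
Proof.
move=> sV; have [i [a [lti es]]] := VE8_vx sV; rewrite es in sV *.
by have [p [-> _]] := choice_vx lti sV; exists i, (p + a).
Qed.

Lemma label_sigma v s t : Lorbit s = Lorbit t ->
  v \in label w s -> v \in label w t -> s = t.
Proof. by rewrite 2!in_set => -> /eqP es /eqP et; exact: etrans (esym es) et. Qed.

Lemma compl_adjGw_vx i j a b : (i < 15)%N -> (j < 15)%N ->
    vx i a \in VE8 -> vx j b \in VE8 ->
  (#|label w (vx i a) :&: label w (vx j b)| == 2%N) =
  compl_adjGw w (vx i a) (vx j b).
Proof.
move=> lti ltj sV tV; rewrite /compl_adjGw /adjGw adjE8_vx //.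
have [eij | nij] := eqVneq i j.
  rewrite -{}eij in tV *.
  (* Within one orbit labels are equal or disjoint, so they share 8 or 0 elements, never 2. On the
     other side w_i is not orthogonal to itself and distinct vertices of the orbit are adjacent in
     G_E8, so the complement has no edge here. *)
  have eO : Lorbit (vx i a) = Lorbit (vx i b) by rewrite !Lorbit_vx.
  have [est | nst] /= := eqVneq (vx i a) (vx i b).
    rewrite est; have [p [-> _]] := choice_vx lti tV.
    by rewrite setIid card_coset_of_stab.
  have [p [_ ew]] := choice_vx lti tV.
  have -> : dotZ (w (Lorbit (vx i a))) (w (Lorbit (vx i b))) != 0.
    rewrite eO; case/orP: ew => /eqP->;
      by rewrite ?dotZNl ?dotZNr ?opprK dotZ_vx addpp orth_self.
  rewrite orth_same_orbit //; last first.
    by apply: contraNN nst => h; rewrite vx_eq // eqxx.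
  apply/eqP=> c2; have /set0Pn[v] : label w (vx i a) :&: label w (vx i b) != set0.
    by rewrite -card_gt0 c2.
  rewrite inE => /andP[va vb].
  by rewrite (label_sigma eO va vb) eqxx in nst.
have [p [-> ew]] := choice_vx lti sV; have [q [-> ew']] := choice_vx ltj tV.
rewrite card_coset_meet size_meet // vx_eq // (negbTE nij) /=.
have -> : (dotZ (w (Lorbit (vx i a))) (w (Lorbit (vx j b))) == 0) = orthc i j (p + q).
  by case/orP: ew => /eqP->; case/orP: ew' => /eqP->;
    rewrite ?dotZNl ?dotZNr ?opprK ?oppr_eq0 dotZ_vx.
(* The constant [orthc i j 0] occurs both for the base points and for the two vertices and cancels;
   what remains is the symplectic product of g with [p + a + q + b], which decides the size of the
   intersection. *)
rewrite (orth_sympl (p + q)) // (orth_sympl (a + b)) // addrACA !symplDr.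
move: (sympl _ p (+) sympl _ q) (sympl _ a (+) sympl _ b) => x y.
by case: orthc; case: x; case: y.
Qed.

Lemma label_inj : {in VE8 &, injective (label w)}.
Proof.
move=> s t sV tV; have [i [a [lti es]]] := VE8_vx sV.
have [j [b [ltj et]]] := VE8_vx tV; rewrite {s}es {t}et in sV tV * => e.
have [p [ei _]] := choice_vx lti sV; have [q [ej _]] := choice_vx ltj tV.
(* Labels from distinct orbits share at most 2 of their 8 elements, so they differ. *)
have [eij | nij] := eqVneq i j; last first.
  have e8 : size (stab_meet i j ((p + a) + (q + b))) = 8%N.
    by rewrite -card_coset_meet -ei -ej -e setIid ei; exact: card_coset_of_stab.
  move: e8; rewrite (size_meet _ lti ltj nij).
  by case: (sympl (common_stab i j) _).
have /set0Pn[v vi] : label w (vx i a) != set0.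
  by rewrite -card_gt0 ei card_coset_of_stab.
apply: (label_sigma _ vi); last by rewrite -e.
by rewrite eij !Lorbit_vx.
Qed.
End OrbitChoice.

(** * Even vectors and independent sets *)

Definition cls (x : F2v) : {set F2v} := [set x; x + one8].

Lemma F2_char (a : 'F_2) : a + a = 0.
Proof. by case: a => [[|[|n]] lt] //; apply/val_inj. Qed.

Lemma F2_cases (a : 'F_2) : a = 0 \/ a = 1.
Proof.
by case: a => [[|[|n]] lt] //; [left | right]; apply/val_inj.
Qed.

Lemma F2v_char (x : F2v) : x + x = 0.
Proof. by apply/rowP=> i; rewrite !mxE F2_char. Qed.

Lemma addKx (x y : F2v) : x + (x + y) = y.
Proof. by rewrite addrA F2v_char add0r. Qed.

Lemma cls_one8 x : cls (x + one8) = cls x.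
Proof. by rewrite /cls -addrA F2v_char addr0 setUC. Qed.

Lemma cls_eq x y : (cls x == cls y) = (x == y) || (x == y + one8).
Proof.
apply/eqP/orP => [e | [/eqP-> //|/eqP->]]; last exact: cls_one8.
by have : x \in cls y; [rewrite -e !inE eqxx | rewrite !inE => /orP].
Qed.

Lemma in_cls x y : (x \in cls y) = (x == y) || (x == y + one8).
Proof. by rewrite !inE. Qed.

Lemma permvD p x y : permv p (x + y) = permv p x + permv p y.
Proof. by apply/rowP=> i; rewrite !mxE. Qed.

Lemma permv_one8 p : permv p one8 = one8.
Proof. by apply/rowP=> i; rewrite !mxE. Qed.

Lemma permv1 x : permv 1 x = x.
Proof. by apply/rowP=> i; rewrite mxE invg1 perm1. Qed.

Lemma permvM p q x : permv p (permv q x) = permv (q * p)%g x.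
Proof. by apply/rowP=> i; rewrite !mxE invMg permM. Qed.

Definition evenv (x : F2v) : bool := \sum_i x 0 i == 0.

Lemma evenvD x y : evenv x -> evenv y -> evenv (x + y).
Proof.
move=> /eqP ex /eqP ey; rewrite /evenv; under eq_bigr do rewrite mxE.
by rewrite big_split /= ex ey addr0.
Qed.

Lemma evenv_permv p x : evenv (permv p x) = evenv x.
Proof.
rewrite /evenv; congr (eq_op _ _); rewrite [RHS](reindex_inj (@perm_inj _ (p^-1)%g)).
by apply: eq_bigr => i _; rewrite mxE.
Qed.

Lemma evenv0 : evenv 0.
Proof. by rewrite /evenv big1 // => i _; rewrite mxE. Qed.

Lemma actFH_cls t p x : actFH t p (cls x) = cls (permv p x + t).
Proof.
by rewrite /actFH imsetU1 imset_set1 permvD permv_one8 addrAC.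
Qed.

Lemma permv_inj p : injective (permv p).
Proof.
by move=> x y /(congr1 (permv p^-1)); rewrite !permvM mulgV !permv1.
Qed.

Lemma actFH_inj t p : injective (actFH t p).
Proof. by apply: imset_inj => x y /addIr/permv_inj. Qed.

Lemma actI_inj t p : injective (actI t p).
Proof. exact/imset_inj/actFH_inj. Qed.

Lemma actFH_comp t p t' q u :
  actFH t p (actFH t' q u) = actFH (permv p t' + t) (q * p)%g u.
Proof.
rewrite /actFH -imset_comp; apply: eq_imset => x /=.
by rewrite permvD permvM addrA.
Qed.

Lemma actI_comp t p t' q I :
  actI t p (actI t' q I) = actI (permv p t' + t) (q * p)%g I.
Proof.
by rewrite /actI -imset_comp; apply: eq_imset => u /=; rewrite actFH_comp.
Qed.

Lemma actI_cls t p (A : {set F2v}) :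
  actI t p (cls @: A) = [set cls (permv p x + t) | x in A].
Proof.
by rewrite /actI -imset_comp; apply: eq_imset => x /=; rewrite actFH_cls.
Qed.

Lemma card_actI t p I : #|actI t p I| = #|I|.
Proof. exact/card_imset/actFH_inj. Qed.

Lemma actI0 I : actI 0 1 I = I.
Proof.
rewrite -[RHS]imset_id; apply: eq_imset => u; rewrite -[RHS]imset_id.
by apply: eq_imset => x; rewrite permv1 addr0.
Qed.

Lemma mem_G1orbit I J : reflect (exists t p, [/\ evenv t, ~~ odd_perm p & J = actI t p I])
  (J \in G1orbit I).
Proof.
apply: (iffP imsetP) => [[[t p]] | [t [p [et ep ->]]]].
  by rewrite inE => /andP[et ep] ->; exists t, p.
by exists (t, p); rewrite ?inE /= ?ep ?andbT.
Qed.

Lemma FHvertsP u : reflect (exists2 x, evenv x & u = cls x) (u \in FHverts).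
Proof.
by apply: (iffP imsetP) => [[x]|[x ex ->]]; [rewrite inE => ex ->|]; exists x.
Qed.

Lemma wtE (x : F2v) : wt x = (\sum_i (x 0%R i != 0%R))%N.
Proof. by rewrite /wt -sum1_card big_mkcond; apply: eq_bigr => i _; rewrite inE; case: eqP. Qed.

Lemma sumF2_wt (x : F2v) : \sum_i x 0 i = (wt x)%:R.
Proof.
rewrite wtE natr_sum; apply: eq_bigr => i _.
by case: (F2_cases (x 0 i)) => ->.
Qed.

Lemma evenv_wt x : evenv x = ~~ odd (wt x).
Proof.
rewrite /evenv sumF2_wt -{1}[wt x]odd_double_half natrD -mul2n natrM.
rewrite (_ : 2%:R = 0 :> 'F_2) ?mul0r ?addr0; last exact/val_inj.
by case: odd.
Qed.

Lemma wt_add_one8 x : (wt x + wt (x + one8)%R = 8)%N.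
Proof.
rewrite !wtE -big_split /= -[RHS](card_ord 8) -sum1_card; apply: eq_bigr => i _.
by rewrite !mxE; case: (F2_cases (x 0 i)) => ->.
Qed.

Lemma wt_eq0 x : wt x = 0%N -> x = 0.
Proof.
move/eqP; rewrite cards_eq0 => /eqP/setP e; apply/rowP=> i; rewrite mxE.
by have := e i; rewrite !inE => /negbFE/eqP.
Qed.

(** The weight is even, and the complementary weight of [x + one8] excludes 6 and 8. *)
Lemma wt4 x : evenv x -> x != 0 -> x != one8 -> wt x != 2%N ->
  wt (x + one8) != 2%N -> wt x = 4%N.
Proof.
rewrite evenv_wt => ev n0 n1 n2 n6; have e8 := wt_add_one8 x.
have p0 : wt x != 0%N by apply: contraNneq n0 => /wt_eq0/eqP.
have p8 : wt (x + one8) != 0%N.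
  by apply: contraNneq n1 => /wt_eq0 e; rewrite -[x](addKx one8) [one8 + x]addrC e addr0.
by move: p0 p8 n2 n6 ev e8; lia.
Qed.

(** * The codes attached to the orbits *)

(* The k-th component of [quad] is the image under [theta] of the k-th generator Z; the images of the generators X are the coordinate functions.  [theta] takes the symplectic form [sympl] to the standard dot product of even vectors. *)
Definition quad (b : bits3) : bits3 :=
  (nth false [:: false; false; false; true; true; true; true; false] (ix b),
   nth false [:: false; false; true; true; true; false; false; true] (ix b),
   nth false [:: false; true; true; false; true; false; true; false] (ix b)).

Definition thetac (v : pauli3) (b : bits3) : bool := dotb v.1 b (+) dotb v.2 (quad b).

Definition theta (v : pauli3) : F2v := \row_k (thetac v (bits_of k))%:R.

Lemma natr_addb (a b : bool) : (a (+) b)%:R = a%:R + b%:R :> 'F_2.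
Proof. by case: a b => [] []; apply/val_inj. Qed.

Lemma thetaD u v : theta (u + v) = theta u + theta v.
Proof.
apply/rowP=> k; rewrite !mxE -natr_addb; congr (nat_of_bool _)%:R.
by rewrite /thetac -[(u + v).1]/(u.1 + v.1) -[(u + v).2]/(u.2 + v.2) !dotbDl addbACA.
Qed.

Lemma theta_bits v k (b : bool) : theta v 0 k = b%:R -> thetac v (bits_of k) = b.
Proof. by rewrite mxE; case: thetac b => [] []. Qed.

Lemma theta_trivial v : theta v = 0 \/ theta v = one8 -> v = 0.
Proof.
have /all_pauli3P h : all (fun v => (all (fun b => ~~ thetac v b) enum_bits3
    || all (fun b => thetac v b) enum_bits3) ==> (v == 0)) enum_pauli3.
  by vm_compute.
move=> e; apply/eqP; move/implyP: (h v); apply.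
case: e => /rowP e; apply/orP; [left | right]; apply/all_bits3P => b.
  by have := e (ix b); rewrite [RHS]mxE => /(@theta_bits v _ false); rewrite ixK => ->.
by have := e (ix b); rewrite [RHS]mxE => /(@theta_bits v _ true); rewrite ixK => ->.
Qed.

Lemma cls_theta_inj : injective (fun v => cls (theta v)).
Proof.
move=> u v /eqP; rewrite cls_eq => e.
suff e0 : u + v = 0 by rewrite -[RHS](addKp u) e0 addr0.
apply: theta_trivial; rewrite thetaD.
case/orP: e => /eqP->; first by left; rewrite F2v_char.
by right; rewrite addrAC F2v_char add0r.
Qed.

Lemma evenv_theta v : evenv (theta v).
Proof.
have /all_pauli3P h : all (fun v => ~~ odd (count (thetac v) enum_bits3)) enum_pauli3.
  by vm_compute.
suff -> : evenv (theta v) = ~~ odd (count (thetac v) enum_bits3) by apply: h.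
rewrite evenv_wt; congr (~~ odd _).
rewrite wtE (reindex ix); last exact: onW_bij ix_bij.
rewrite [LHS]big_bits3 -sum1_count [RHS]big_mkcond.
by apply: eq_bigr => b _; rewrite mxE ixK; case: thetac.
Qed.

Definition code (i : nat) (c : pauli3) : {set {set F2v}} :=
  [set cls (theta v) | v in coset_of_stab i c].

Lemma card_code i c : (i < 15)%N -> #|code i c| = 8%N.
Proof. by move=> lti; rewrite card_imset ?card_coset_of_stab //; apply: cls_theta_inj. Qed.

Lemma code_translate i c : code i c = actI (theta c) 1 (code i 0).
Proof.
rewrite /code /actI -imset_comp; apply/setP=> u; apply/imsetP/imsetP => -[v].
  rewrite inE => h ->; exists (v + c); first by rewrite inE addr0.
  by rewrite /= actFH_cls permv1 -thetaD -addrA addpp addr0.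
rewrite inE addr0 => h ->; exists (v + c); first by rewrite inE -addrA addpp addr0.
by rewrite /= actFH_cls permv1 -thetaD.
Qed.

(** The permutation with cycles 0 1 2 and 3 4 5 6 7 on the indices. *)
Definition rotb (b : bits3) : bits3 := bits_of (nth 0%N [:: 1; 2; 0; 4; 5; 6; 7; 3]%N (ix b)).

Definition rot8 (k : 'I_8) : 'I_8 := ix (rotb (bits_of k)).

Lemma rot8_inj : injective rot8.
Proof.
have /all_bits3P h : all (fun b => all (fun c => (rotb b == rotb c) ==> (b == c))
    enum_bits3) enum_bits3 by vm_compute.
move=> k l /(can_inj ixK)/eqP e; apply: (can_inj bits_ofK); apply/eqP.
by have /all_bits3P/(_ (bits_of l))/implyP/(_ e) := h (bits_of k).
Qed.

(* The square of a permutation of cycle type 3 + 5, hence even; it has order 15 and permutes the codes transitively, like a Singer cycle of A_8 = L_4(2). *)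
Definition singer : {perm 'I_8} := ((perm rot8_inj * perm rot8_inj)^-1)%g.

Lemma singer_even : odd_perm singer = false.
Proof. by rewrite odd_permV odd_permM addbb. Qed.

Lemma code_singer i : (i < 14)%N -> actI 0 singer (code i 0) = code i.+1 0.
Proof.
have /all_iotaP h : all (fun i =>
    let S' := [seq t <- enum_pauli3 | stab i.+1 t] in
    (* A word may be matched with a word of the next code or with its complement, since both give
       the same class. *)
    all (fun v => has (fun v' =>
      all (fun b => thetac v (rotb (rotb b)) == thetac v' b) enum_bits3 ||
      all (fun b => thetac v (rotb (rotb b)) == ~~ thetac v' b) enum_bits3) S')
    [seq t <- enum_pauli3 | stab i t]) (iota 0 14).
  by vm_compute.
move=> lti; have lti' : (i < 15)%N := leqW lti.
apply/eqP; rewrite eqEcard card_actI !card_code // andbT.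
apply/subsetP=> _ /imsetP[_ /imsetP[v + ->] ->]; rewrite inE addr0 => sv.
have /allP/(_ v) := h i lti; rewrite mem_filter sv mem_enum_pauli3 => /(_ isT).
case/hasP=> v'; rewrite mem_filter => /andP[sv' _] e.
apply/imsetP; exists v'; first by rewrite inE addr0.
rewrite actFH_cls addr0; apply/eqP; rewrite cls_eq.
(* [permv] reads its argument through the inverse permutation, and [singer] is itself an inverse
   square; hence the double [rotb]. *)
have ev k : permv singer (theta v) 0 k = (thetac v (rotb (rotb (bits_of k))))%:R.
  by rewrite !mxE invgK permM !permE /rot8 !ixK.
case/orP: e => /all_bits3P e; apply/orP; [left | right]; apply/eqP/rowP=> k;
  rewrite ev (eqP (e _)) !mxE //.
by case: thetac; apply/val_inj.
Qed.

Lemma code_orbit i : (i < 15)%N ->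
  exists2 p, odd_perm p = false & code i 0 = actI 0 p (code 0 0).
Proof.
elim: i => [_ | i IHi lti]; first by exists 1%g; rewrite ?odd_perm1 ?actI0.
have [p ep e] := IHi (ltnW lti); exists (p * singer)%g.
  by rewrite odd_permM ep singer_even.
rewrite -(code_singer lti) e actI_comp; congr actI.
by rewrite addr0; apply/rowP=> k; rewrite !mxE.
Qed.

(** * Independent sets with an orbit of size 120 *)

Lemma evenv_one8 : evenv one8.
Proof.
rewrite /evenv; under eq_bigr do rewrite mxE.
by rewrite sumr_const card_ord; apply/eqP/val_inj.
Qed.

Lemma wt_permv p x : wt (permv p x) = wt x.
Proof.
rewrite !wtE [RHS](reindex_inj (@perm_inj _ (p^-1)%g)).
by apply: eq_bigr => i _; rewrite mxE.
Qed.

Lemma adjFH_act t p u v : adjFH (actFH t p u) (actFH t p v) -> adjFH u v.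
Proof.
case/existsP=> _ /andP[/imsetP[x xu ->] /existsP[_ /andP[/imsetP[y yv ->]]]].
(* The two copies of [t] cancel, and a permutation preserves weights and [one8]. *)
rewrite addrACA F2v_char addr0 -permvD wt_permv -{1}(permv_one8 p) -permvD wt_permv => h.
by apply/existsP; exists x; rewrite xu; apply/existsP; exists y; rewrite yv.
Qed.

Lemma indep8_act t p I : evenv t -> indep8 I -> indep8 (actI t p I).
Proof.
move=> et /and3P[/subsetP sI cI /forallP aI]; apply/and3P; split.
- apply/subsetP=> _ /imsetP[u /sI/FHvertsP[x ex ->] ->]; apply/FHvertsP.
  by exists (permv p x + t); rewrite ?actFH_cls ?evenvD ?evenv_permv.
- by rewrite card_actI.
apply/forallP=> ?; apply/implyP=> /imsetP[u uI ->].
apply/forallP=> ?; apply/implyP=> /imsetP[v vI ->].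
move/implyP: (aI u) => /(_ uI)/forallP/(_ v)/implyP/(_ vI).
exact/contraNN/adjFH_act.
Qed.

(** Translations as an action of the additive group of [F2v], whose group unit is 0 and whose group
    product is addition. *)
Definition trans (I : {set {set F2v}}) (t : F2v) := actI t 1 I.

Lemma trans0 : trans^~ 1%g =1 id.
Proof. exact: actI0. Qed.

Lemma transM I : act_morph trans I.
Proof.
by move=> s t; rewrite /trans actI_comp permv1 mul1g.
Qed.

Definition trans_action := TotalAction trans0 transM.

Lemma even_group_set : group_set [set x : F2v | evenv x].
Proof.
apply/group_setP; split=> [|x y]; first by rewrite inE evenv0.
by rewrite !inE; apply: evenvD.
Qed.

Definition even_group := Group even_group_set.

Lemma card_F2v : #|[set: F2v]| = 256%N.
Proof. by rewrite cardsT card_mx card_Fp. Qed.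

(** Adding a unit vector sends the odd vectors injectively to even ones, so the latter make up at
    least half of 256. *)
Lemma card_even_group : (128 <= #|even_group|)%N.
Proof.
pose e : F2v := delta_mx 0 0.
have le : (#|~: even_group| <= #|even_group|)%N.
  rewrite -(card_imset _ (addrI e)); apply/subset_leq_card/subsetP.
  move=> _ /imsetP[x + ->]; rewrite !inE /evenv => nx.
  under eq_bigr do rewrite mxE; rewrite big_split /=.
  rewrite (bigD1 ord0) //= big1 => [|i /negbTE ni]; last by rewrite !mxE ni.
  rewrite !mxE !eqxx /= addr0.
  by case: (F2_cases (\sum_i x 0 i)) nx => ->; rewrite ?eqxx.
have := cardsC even_group; rewrite -cardsT card_F2v; lia.
Qed.

(** Translation orbits have lengths that are powers of 2. If every stabiliser had at most 15
    elements, all lengths would be multiples of 16, and so would their sum 120. *)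
Lemma large_stabilizer I : #|G1orbit I| = 120%N ->
  exists2 J, J \in G1orbit I & (16 <= #|'C_even_group[J | trans_action]%g|)%N.
Proof.
move=> c120; apply/exists_inP; apply: contraT => /exists_inPn small.
have acts : [acts even_group, on G1orbit I | trans_action].
  apply/subsetP=> t; rewrite !inE /= => et; apply/subsetP=> J.
  case/mem_G1orbit=> s [p [es ep ->]]; rewrite inE; apply/mem_G1orbit.
  exists (s + t), p; split=> //; first exact: evenvD.
  by rewrite /= /trans actI_comp permv1 mulg1.
have := acts_sum_card_orbit acts; rewrite c120 => e.
have : (16 %| 120)%N; last by [].
rewrite -e; apply: dvdn_sum => _ /imsetP[J JO ->].
have eo := card_orbit_stab trans_action even_group J.
have od : (#|orbit trans_action even_group J| %| 2 ^ 8)%N.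
  rewrite -[(2 ^ 8)%N]card_F2v; apply: dvdn_trans (cardSg (subsetT even_group)).
  by rewrite -eo dvdn_mulr.
have := small J JO; rewrite -leqNgt => le15; have ge := card_even_group.
have /(dvdn_pfactor _ _ (isT : prime 2))[k _ ok] := od; rewrite ok in eo *.
have [le4 | lt4] := leqP 4 k; first exact: (dvdn_exp2l 2 le4).
(* Length at most 8 and stabiliser at most 15 would give a group of order at most 120, below 128. *)
have le8 := leq_pexp2l (isT : (0 < 2)%N) (lt4 : (k <= 3)%N).
by have := leq_trans ge (eq_leq (esym eo)) => /leq_trans/(_ (leq_mul le8 le15)).
Qed.

(** The stabiliser H moves one point of J to at least 16 / 2 = 8 classes, hence to all of J.
    Translating that point to 0 turns J into H modulo [one8], and independence forbids the weights 2
    and 6 in H. *)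
Lemma affine_form I : indep8 I -> #|G1orbit I| = 120%N ->
  exists t q (H : {group F2v}),
    [/\ evenv t, actI t q I = cls @: H, (16 <= #|H|)%N, one8 \in H &
      forall h, h \in H -> h != 0 -> h != one8 -> wt h = 4%N].
Proof.
move=> iI /large_stabilizer[J /mem_G1orbit[s [p [es _ eJ]]] lC].
have iJ : indep8 J by rewrite eJ indep8_act.
case/and3P: (iJ) => /subsetP sJ /eqP cJ /forallP aJ.
have /card_gt0P[u uJ] : (0 < #|J|)%N by rewrite cJ.
have /FHvertsP[x ex eu] := sJ _ uJ; rewrite {u}eu in uJ.
set H := 'C_even_group[J | trans_action]%G in lC *.
have HJ h : h \in H -> cls (x + h) \in J.
  case/setIP=> _ /astab1P /= eh.
  by rewrite -eh; apply/imsetP; exists (cls x); rewrite // actFH_cls permv1.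
pose K := [set cls (x + h) | h in H].
have KJ : K = J.
  apply/eqP; rewrite eqEcard cJ; apply/andP; split.
    by apply/subsetP=> _ /imsetP[h /HJ ? ->].
  have leHK : (#|H| <= #|K| * 2)%N.
    (* The first coordinate separates [h] from [h + one8], so at most two elements of H give the
       same class. *)
    pose f h := (cls (x + h), h 0 0 : 'F_2).
    have injf : injective f.
      move=> h h' [/eqP]; rewrite cls_eq => /orP[/eqP/addrI // | /eqP].
      by rewrite -addrA => /addrI-> /eqP; rewrite !mxE -subr_eq0 addrAC subrr.
    have -> : (#|K| * 2)%N = #|setX K [set: 'F_2]| by rewrite cardsX cardsT card_Fp.
    rewrite -(card_imset _ injf).
    apply/subset_leq_card/subsetP=> _ /imsetP[h hH ->].
    by rewrite !inE andbT; apply: imset_f.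
  by have := leq_trans lC leHK; rewrite -[16%N]/(8 * 2)%N leq_pmul2r.
exists (s + x), p, H; split=> //.
- exact: evenvD.
- have -> : actI (s + x) p I = actI x 1 J by rewrite eJ actI_comp permv1 mulg1.
  rewrite -KJ /actI -imset_comp; apply: eq_imset => h /=.
  by rewrite actFH_cls permv1 addrC addKx.
- apply/setIP; split.
    by rewrite inE evenv_one8.
  apply/astab1P; rewrite /= /trans -[RHS]imset_id; apply: eq_in_imset.
  move=> v /sJ/FHvertsP[y _ ->]; by rewrite actFH_cls permv1 cls_one8.
move=> h hH n0 n1.
have hE : evenv h by case/setIP: hH; rewrite inE.
have := HJ _ hH => vJ.
have nadj : ~~ adjFH (cls x) (cls (x + h)).
  by move/implyP: (aJ (cls x)) => /(_ uJ)/forallP/(_ (cls (x + h)))/implyP/(_ vJ).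
have [n2 n6] : wt h != 2%N /\ wt (h + one8) != 2%N.
  apply/andP; rewrite -negb_or; apply: contraNN nadj => w2.
  apply/existsP; exists x; rewrite in_cls eqxx; apply/existsP; exists (x + h).
  by rewrite in_cls eqxx addKx.
exact: wt4.
Qed.

(** * Recognising the extended Hamming code *)

Lemma exists_notin (T : finType) (A : {set T}) (l : seq T) :
  (size l < #|A|)%N -> exists2 x, x \in A & x \notin l.
Proof.
move=> lt; apply/subsetPn; apply: contraTN lt => /subset_leq_card h.
by rewrite -leqNgt (leq_trans h) // card_size.
Qed.

Section Coordinates.
Variables a b c : F2v.

(** The columns of the generator matrix with rows [a], [b], [c]. *)
Definition column (i : 'I_8) : bits3 := (a 0 i != 0, b 0 i != 0, c 0 i != 0).

Definition comb (x : bits3) : F2v := \row_i (dotb x (column i))%:R.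

Lemma combE x : comb x = (if x.1.1 then a else 0) + (if x.1.2 then b else 0)
  + (if x.2 then c else 0).
Proof.
apply/rowP=> i; rewrite !mxE /dotb /column /=.
case: x => [[[] []] []] /=; rewrite ?mxE;
  by case: (F2_cases (a 0 i)) => ea; case: (F2_cases (b 0 i)) => eb;
     case: (F2_cases (c 0 i)) => ec; rewrite ?ea ?eb ?ec; apply/val_inj.
Qed.

(* The seven weights determine the number of coordinates with a given column by Fourier inversion on F_2^3. *)
Lemma column_inj : (forall x, x != 0 -> wt (comb x) = 4%N) -> injective column.
Proof.
move=> w4; pose n y := #|[set i | column i == y]|.
have wtn x : wt (comb x) = (\sum_(y <- enum_bits3) dotb x y * n y)%N.
  rewrite wtE -big_bits3 (partition_big column xpredT) //=; apply: eq_bigr => y _.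
  rewrite /n -sum1_card big_distrr /=; apply: eq_big => [i|i /eqP e].
    by rewrite inE.
  by rewrite mxE e; case: dotb.
have n8 : (\sum_(y <- enum_bits3) n y = 8)%N.
  rewrite -big_bits3 -[RHS](card_ord 8) -sum1_card [RHS](partition_big column xpredT) //=.
  by apply: eq_bigr => y _; rewrite /n -sum1_card; apply: eq_bigl => i; rewrite inE.
have n1 y : (n y <= 1)%N.
  have w x : x != 0 -> (\sum_(y <- enum_bits3) dotb x y * n y)%N = 4%N.
    by move=> /w4; rewrite wtn.
  have := w (false, false, true) isT; have := w (false, true, false) isT.
  have := w (false, true, true) isT; have := w (true, false, false) isT.
  have := w (true, false, true) isT; have := w (true, true, false) isT.
  have := w (true, true, true) isT.
  move: n8; rewrite !unlock /= /dotb /=.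
  move: y => [[[] []] []]; move: (n (false, false, false)) (n (false, false, true))
    (n (false, true, false)) (n (false, true, true)) (n (true, false, false))
    (n (true, false, true)) (n (true, true, false)) (n (true, true, true)); lia.
move=> i j e; apply/eqP; apply: contraT => ne.
have := n1 (column i); rewrite leqNgt => /negP[].
have <- : #|[set i; j]| = 2%N by rewrite cards2 ne.
by apply/subset_leq_card/subsetP=> k; rewrite !inE => /orP[] /eqP->; rewrite ?e.
Qed.
End Coordinates.

(** The columns for three suitable words of H are the eight vectors of F_2^3, each once. Sorting the
    coordinates by column turns the combinations of these words into the linear functions on F_2^3,
    which represent [code 0 0]. *)
Lemma code_form I : indep8 I -> #|G1orbit I| = 120%N ->
  exists t q, evenv t /\ actI t q I = code 0 0.
Proof.
move=> iI oI; have [t [p [H [et eI cH oneH w4]]]] := affine_form iI oI.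
(* Each of [a], [b], [c] avoids the span of [one8] and its predecessors; these spans have 2, 4 and 8
   elements, fewer than the 16 of H. *)
have [a aH na] : exists2 a, a \in H & a \notin [:: 0; one8].
  by apply: exists_notin; apply: leq_trans cH.
have [b bH nb] : exists2 b, b \in H & b \notin [:: 0; one8; a; a + one8].
  by apply: exists_notin; apply: leq_trans cH.
have [c cHin nc] : exists2 c, c \in H & c \notin
    [:: 0; one8; a; a + one8; b; b + one8; a + b; a + b + one8].
  by apply: exists_notin; apply: leq_trans cH.
have addH x y : x \in H -> y \in H -> x + y \in H by apply: groupM.
have H0 : 0 \in H by apply: group1.
have combH x : comb a b c x \in H.
  by rewrite combE; apply: (addH _ _); [apply: (addH _ _) |]; case: ifP.
have combN x e : x != 0 -> e \in [:: 0; one8] -> comb a b c x != e.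
  rewrite !inE => nx /orP ee; apply/eqP; rewrite combE.
  (* Solving for the last generator with nonzero coefficient would put it in its excluded list. *)
  move: nx; case: x => [[x y] []] nx /=.
    move/(congr1 (+%R ((if x then a else 0) + (if y then b else 0)))).
    rewrite addKx => ec; move: nc; rewrite {1}ec !inE.
    by case: x y {nx ec} => [] []; case: ee => /eqP->;
      rewrite ?addr0 ?add0r eqxx ?orbT.
  rewrite addr0; case: y nx => nx.
    move/(congr1 (+%R (if x then a else 0))); rewrite addKx => eb.
    move: nb; rewrite {1}eb !inE.
    by case: x {nx eb}; case: ee => /eqP->; rewrite ?addr0 ?add0r eqxx ?orbT.
  rewrite addr0; case: x nx => // _ ea; move: na; rewrite ea !inE.
  by case: ee => /eqP->; rewrite eqxx ?orbT.
have comb4 x : x != 0 -> wt (comb a b c x) = 4%N.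
  by move=> nx; apply: w4; rewrite ?combN // !inE eqxx ?orbT.
have injc := column_inj comb4.
have injq : injective (fun i => ix (column a b c i)).
  by move=> i j /(can_inj ixK)/injc.
pose q := perm injq.
have permq x : permv q (comb a b c x) = theta (x, 0).
  apply/rowP=> k; rewrite !mxE; congr (nat_of_bool _)%:R.
  have -> : bits_of k = column a b c ((q^-1)%g k).
    by rewrite -{1}(permKV q k) [q _]permE ixK.
  by rewrite /thetac /= (_ : dotb 0 _ = false) ?addbF.
exists (permv q t), (p * q)%g; split; first by rewrite evenv_permv.
have -> : actI (permv q t) (p * q)%g I = actI 0 q (cls @: H).
  by rewrite -eI actI_comp addr0.
have c8 : #|cls @: H| = 8%N.
  by rewrite -eI card_actI; case/and3P: iI => _ /eqP.
apply/esym/eqP; rewrite eqEcard card_actI c8 card_code // andbT.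
apply/subsetP=> _ /imsetP[v + ->]; rewrite inE addr0 => sv.
(* The representative of index 0 is the all-ones vector, fixed up to sign only by elements without Z
   part. *)
have v2 : v.2 = 0.
  have /all_pauli3P h : all (fun v => stab 0 v ==> (v.2 == 0)) enum_pauli3.
    by vm_compute.
  by apply/eqP; move/implyP: (h v); apply.
rewrite actI_cls; apply/imsetP; exists (comb a b c v.1) => //.
by rewrite permq addr0 -v2 -surjective_pairing.
Qed.

(** * The isomorphism built from labels and codes *)

Theorem theorem3p12 :
  forall w : {set {set cvec}} -> 'cV[int]_8,
    (forall s, s \in VE8 ->
       E8root (w (Lorbit s)) && (vertex_of (w (Lorbit s)) \in Lorbit s)) ->
  forall I0 : {set {set F2v}},
    indep8 I0 -> #|G1orbit I0| = 120%N ->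
    graph_iso VE8 (compl_adjGw w) (G1orbit I0) adjG1.
Proof.
move=> w wP I0 iI oI; have [t [q [et eq]]] := code_form iI oI.
(* [r] is given the parity of [q], so that the total permutation carrying [I0] to [f s] is even. *)
pose r : {perm 'I_8} := if odd_perm q then tperm ord0 ord_max else 1%g.
have er : odd_perm r = odd_perm q.
  by rewrite /r; case: (odd_perm q); rewrite ?odd_tperm ?odd_perm1.
pose f s := actI 0 r [set cls (theta v) | v in label w s].
have fcap s s' : #|f s :&: f s'| = #|label w s :&: label w s'|.
  rewrite /f /actI -imsetI ?card_imset; last by move=> u v _ _; apply: actFH_inj.
  - rewrite -imsetI ?card_imset //; first exact: cls_theta_inj.
    by move=> u v _ _; apply: cls_theta_inj.
  - exact: actFH_inj.
have finj : {in VE8 &, injective f}.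
  move=> s s' sV s'V /actI_inj/(imset_inj cls_theta_inj).
  exact: label_inj.
exists f; split=> //; last first.
  move=> s s' sV s'V; rewrite /adjG1 fcap.
  have [i [a [lti es]]] := VE8_vx sV; have [j [b [ltj es']]] := VE8_vx s'V.
  by rewrite es es' in sV s'V *; apply: compl_adjGw_vx.
apply/eqP; rewrite eqEcard oI card_in_imset // card_VE8_ge andbT.
apply/subsetP=> _ /imsetP[s sV ->].
have [i [c [lti el]]] := label_coset wP sV.
have [p ep ec] := code_orbit lti.
(* [f s] arises from [I0] by [q] and [t], then the even [p], then translation by [theta c], then
   [r]. *)
rewrite /f el -/(code i c) code_translate ec -eq !actI_comp.
apply/mem_G1orbit; eexists; eexists; split; last by [].
  by rewrite !(evenvD, evenv_permv, evenv_theta, evenv0).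
by rewrite !odd_permM er ep odd_perm1; case: (odd_perm q).
Qed.
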